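(* For all LTL$_f$ formulas $\varphi_1,\varphi_2$ such that $\forall\varphi_2$ is consistent (some environment strategy enforces it), Algorithm 5 (described below) solves the synthesis under environment specifications problem with $\mathit{Task}=\forall\varphi_1$ and $\mathit{Env}=\forall\varphi_2$: if it outputs ''Unrealisable'' then no agent strategy enforces $\forall\varphi_1$ under $\forall\varphi_2$, and otherwise its output is a finite-state agent strategy that enforces $\forall\varphi_1$ under $\forall\varphi_2$. Algorithm 5: let $(\mathcal D_1,\mathrm{safe}(T_1))=\mathrm{ConvertDA}(\forall\varphi_1)$ with state set $Q_1$, and $(\mathcal D_2,\mathrm{safe}(T_2))=\mathrm{ConvertDA}(\forall\varphi_2)$. Compute $(S_2,f_{env})=\mathrm{Solve}_{env}(\mathcal D_2,\mathrm{safe}(T_2))$ (the environment being the protagonist). Let $\mathcal D_2'=\mathrm{Restrict}(\mathcal D_2,S_2)$ with sink $\bot_2$, and $\mathcal D=\mathrm{Product}(\mathcal D_1,\mathcal D_2')$ with initial state $\iota$. Compute $(S,f)=\mathrm{Solve}_{ag}(\mathcal D,\mathrm{safe}((T_1\times S_2)\cup(Q_1\times\{\bot_2\})))$. If $\iota\notin S$ output ''Unrealisable''; otherwise output $\mathrm{Strategy}(\mathcal D,f)$.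
   Context: Fix a finite set $\mathcal P$ of atomic propositions partitioned into disjoint sets $\mathcal X$ (environment-controlled) and $\mathcal Y$ (agent-controlled); $\Sigma=2^{\mathcal P}$. LTL$_f$ formulas: $\varphi ::= p \mid \neg\varphi\mid \varphi\wedge\varphi\mid \mathsf{X}\varphi\mid \varphi\,\mathsf{U}\,\varphi$, evaluated on finite nonempty traces with standard finite-trace semantics ($\mathsf X\varphi$ holds at $i$ iff $i<|\pi|-1$ and $\varphi$ holds at $i+1$; $\varphi_1\mathsf U\varphi_2$ holds at $i$ iff $\varphi_2$ holds at some $j$ with $i\le j<|\pi|$ and $\varphi_1$ holds at all $k$ with $i\le k<j$); $\pi\models\varphi$ means $\varphi$ holds at position 0. $\forall\varphi$ is the set of infinite traces all of whose finite nonempty prefixes satisfy $\varphi$. Agent strategies are $\sigma_{ag}:(2^{\mathcal X})^*\to2^{\mathcal Y}$, environment strategies $\sigma_{env}:(2^{\mathcal Y})^+\to2^{\mathcal X}$; the agent moves first: $(Y_0\cup X_0)(Y_1\cup X_1)\cdots$ follows $\sigma_{ag}$ iff $Y_0=\sigma_{ag}(\epsilon)$, $Y_{i+1}=\sigma_{ag}(X_0\cdots X_i)$, and follows $\sigma_{env}$ iff $X_i=\sigma_{env}(Y_0\cdots Y_i)$; $\mathrm{play}(\sigma_{ag},\sigma_{env})$ is the unique trace following both. An environment strategy enforces $P\subseteq\Sigma^\omega$ iff its play against every agent strategy lies in $P$. $\sigma_{ag}$ enforces $\mathit{Task}$ under $\mathit{Env}$ iff $\mathrm{play}(\sigma_{ag},\sigma_{env})\in\mathit{Task}$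 for every environment strategy $\sigma_{env}$ that enforces $\mathit{Env}$. A strategy is finite-state if computed by a finite-state transducer. Building blocks: a transition system $\mathcal D=(\Sigma,Q,\iota,\delta)$ ($Q$ finite, $\delta:Q\times\Sigma\to Q$); $\mathcal D_q$ is $\mathcal D$ with initial state $q$. For an LTL$_f$ formula $\varphi$ let $\mathcal M_\varphi=(\Sigma,Q,\iota,\delta,F)$ be a DFA accepting exactly the finite nonempty traces satisfying $\varphi$. For $T\subseteq Q$, $\mathrm{safe}(T)$ is the set of infinite runs lying in $T$ at every index. $\mathrm{ConvertDA}(\forall\varphi)=((\Sigma,Q,\iota,\delta),\mathrm{safe}(F\cup\{\iota\}))$. Game on $(\mathcal D,\alpha)$: an agent strategy wins from $q$ if the run of $\mathcal D_q$ on every infinite trace following it lies in $\alpha$; an environment strategy wins from $q$ if the run of $\mathcal D_q$ on every trace following it lies in $\alpha$. For $p\in\{ag,env\}$, $\mathrm{Solve}_p(\mathcal D,\alpha)$ (with $\alpha$ a safety condition) returns the winning region of $p$ (the set of states from which $p$ has a winning strategy) and a positional function (for $p=ag$, $f:Q\to2^{\mathcal Y}$; for $p=env$, $f:Q\times2^{\mathcal Y}\to2^{\mathcal X}$) whose induced strategy wins from every state of that region. For $f:Q\to2^{\mathcal Y}$, $\mathrm{Strategy}(\mathcal D,f)$ is the agent strategy with $\sigma(\epsilon)=f(\iota)$ and $\sigma(X_0\cdots X_k)=f(q_{k+1})$, where $q_0\cdots q_{k+1}$ is the run of $\mathcal D$ on $(Y_0\cup X_0)\cdots(Y_k\cup X_k)$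 and $Y_0,\dots,Y_k$ are the agent's own previous moves under $\sigma$. $\mathrm{Restrict}(\mathcal D,S)$ for $S\subseteq Q$ is the transition system with states $S\cup\{\bot\}$ ($\bot$ a fresh sink), the same initial state, $\delta'(q,z)=\delta(q,z)$ if $\delta(q,z)\in S$, $\delta'(q,z)=\bot$ otherwise, and $\delta'(\bot,z)=\bot$. $\mathrm{Product}(\mathcal D_1,\mathcal D_2)$ is the synchronous product: states $Q_1\times Q_2$, initial state $(\iota_1,\iota_2)$, $\delta((q_1,q_2),z)=(\delta_1(q_1,z),\delta_2(q_2,z))$.
   Formalization: The DFA for each formula is additionally assumed never to return to its initial state on a nonempty word; otherwise safe(F ∪ {ι}) need not capture ∀φ and the claim fails, e.g. for ''p holds at the last position'' with its two-state DFA. *)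

(* Defs.v *)
From mathcomp Require Import all_boot.

Set Implicit Arguments.
Unset Strict Implicit.
Unset Printing Implicit Defensive.

(* The set of atomic propositions, partitioned into environment-controlled
   ones [X] and agent-controlled ones [Y], is the disjoint sum [X + Y]; a
   letter is an arbitrary set of atomic propositions. *)
Notation letter X Y := {set (X + Y)%type}.
Notation trace X Y := (nat -> letter X Y).

Definition join (X Y : finType) (y : {set Y}) (x : {set X}) : letter X Y :=
  (inr @: y) :|: (inl @: x).
Definition ag_part (X Y : finType) (z : letter X Y) : {set Y} :=
  [set p | inr p \in z].
Definition env_part (X Y : finType) (z : letter X Y) : {set X} :=
  [set p | inl p \in z].

(** LTLf *)

Inductive ltlf (X Y : finType) : Type :=
| Atom of X + Y
| Not of ltlf X Y
| And of ltlf X Y & ltlf X Y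
| Next of ltlf X Y
| Until of ltlf X Y & ltlf X Y.

Fixpoint holds_at (X Y : finType) (w : seq (letter X Y)) (i : nat)
    (phi : ltlf X Y) : Prop :=
  match phi with
  | Atom p => p \in nth set0 w i
  | Not phi1 => ~ holds_at w i phi1
  | And phi1 phi2 => holds_at w i phi1 /\ holds_at w i phi2
  | Next phi1 => i < size w - 1 /\ holds_at w i.+1 phi1
  | Until phi1 phi2 => exists j, [/\ i <= j < size w, holds_at w j phi2
      & forall k, i <= k < j -> holds_at w k phi1]
  end.

(* Only meaningful for nonempty [w]. *)
Definition models (X Y : finType) (w : seq (letter X Y)) (phi : ltlf X Y) :=
  holds_at w 0 phi.

(* [mkseq tau n] is the prefix of [tau] of length [n]. *)
Definition all_prefixes (X Y : finType) (phi : ltlf X Y) (tau : trace X Y) :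
    Prop :=
  forall n, 0 < n -> models (mkseq tau n) phi.

(** Strategies *)

Definition ag_strategy (X Y : finType) : Type := seq {set X} -> {set Y}.
(* The value on the empty sequence is never used. *)
Definition env_strategy (X Y : finType) : Type := seq {set Y} -> {set X}.

Definition follows_ag (X Y : finType) (sag : ag_strategy X Y)
    (tau : trace X Y) : Prop :=
  forall i, ag_part (tau i) = sag (mkseq (fun j => env_part (tau j)) i).

Definition follows_env (X Y : finType) (senv : env_strategy X Y)
    (tau : trace X Y) : Prop :=
  forall i, env_part (tau i) = senv (mkseq (fun j => ag_part (tau j)) i.+1).

Fixpoint play_prefix (X Y : finType) (sag : ag_strategy X Y)
    (senv : env_strategy X Y) (n : nat) : seq (letter X Y) :=
  if n is m.+1 then
    let h := play_prefix sag senv m in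
    let y := sag (map (@env_part X Y) h) in
    let x := senv (rcons (map (@ag_part X Y) h) y) in
    rcons h (join y x)
  else [::].

Definition play (X Y : finType) (sag : ag_strategy X Y)
    (senv : env_strategy X Y) : trace X Y :=
  fun n => nth set0 (play_prefix sag senv n.+1) n.

Definition env_enforces (X Y : finType) (senv : env_strategy X Y)
    (P : trace X Y -> Prop) : Prop :=
  forall sag : ag_strategy X Y, P (play sag senv).

Definition consistent (X Y : finType) (P : trace X Y -> Prop) : Prop :=
  exists senv : env_strategy X Y, env_enforces senv P.

Definition enforces_under (X Y : finType) (sag : ag_strategy X Y)
    (Task Env : trace X Y -> Prop) : Prop :=
  forall senv : env_strategy X Y,
    env_enforces senv Env -> Task (play sag senv).

(* The transducer is of Moore type, since the agent moves first. *)
Definition finite_state (X Y : finType) (sag : ag_strategy X Y) : Prop :=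
  exists (Q : finType) (q0 : Q) (step : Q -> {set X} -> Q) (out : Q -> {set Y}),
    forall h, sag h = out (foldl step q0 h).

(** Transition systems and automata *)

Record tsys (X Y : finType) : Type := TSys {
  state :> finType;
  init : state;
  delta : state -> letter X Y -> state }.

Definition with_init (X Y : finType) (D : tsys X Y) (q : D) : tsys X Y :=
  @TSys X Y D q (@delta X Y D).

Definition run (X Y : finType) (D : tsys X Y) (tau : trace X Y) : nat -> D :=
  fun n => foldl (@delta X Y D) (init D) (mkseq tau n).

Definition safe (Q : finType) (T : {set Q}) (rho : nat -> Q) : Prop :=
  forall n, rho n \in T.

Record dfa (X Y : finType) : Type := DFA {
  dfa_tsys :> tsys X Y;
  final : {set dfa_tsys} }.

Definition accepts (X Y : finType) (M : dfa X Y) (w : seq (letter X Y)) : bool :=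
  foldl (@delta X Y M) (init M) w \in final M.

Definition recognizes (X Y : finType) (M : dfa X Y) (phi : ltlf X Y) : Prop :=
  forall w, accepts M w <-> w <> [::] /\ models w phi.

(* Without this, adding the initial state to the safe states is unsound: for
   the formula "p holds at the last position" the two-state minimal DFA has
   all its states in [final M :|: [set init M]]. *)
Definition init_not_reentered (X Y : finType) (M : dfa X Y) : Prop :=
  forall w, w <> [::] -> foldl (@delta X Y M) (init M) w <> init M.

Definition dfa_construction (X Y : finType) (dfa_of : ltlf X Y -> dfa X Y) :
    Prop :=
  forall phi, recognizes (dfa_of phi) phi /\ init_not_reentered (dfa_of phi).

(* The set [T] such that ConvertDA returns [(M, safe T)]. *)
Definition convert_safe (X Y : finType) (M : dfa X Y) : {set M} :=
  final M :|: [set init M].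

(** Games *)

Definition wins_ag (X Y : finType) (D : tsys X Y) (alpha : (nat -> D) -> Prop)
    (q : D) (sag : ag_strategy X Y) : Prop :=
  forall tau, follows_ag sag tau -> alpha (run (with_init q) tau).

Definition wins_env (X Y : finType) (D : tsys X Y) (alpha : (nat -> D) -> Prop)
    (q : D) (senv : env_strategy X Y) : Prop :=
  forall tau, follows_env senv tau -> alpha (run (with_init q) tau).

(* The agent's own move in state [q] is [f q], so the state reached after the
   environment moves [h] is obtained by reading the letters [join (f q) x]. *)
Definition strategy_of (X Y : finType) (D : tsys X Y) (f : D -> {set Y}) :
    ag_strategy X Y :=
  fun h => f (foldl (fun q x => delta q (join (f q) x)) (init D) h).

(* Likewise, [Y_0 ... Y_k] is mapped to [f q_k Y_k] where [q_0 = init D] and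
   [q_(i+1) = delta q_i (join Y_i (f q_i Y_i))]. *)
Definition env_strategy_of (X Y : finType) (D : tsys X Y)
    (f : D -> {set Y} -> {set X}) : env_strategy X Y :=
  fun h => if h is y0 :: h' then
      f (foldl (fun q y => delta q (join y (f q y))) (init D) (belast y0 h'))
        (last y0 h')
    else set0.

Definition ag_solver (X Y : finType) : Type :=
  forall (D : tsys X Y) (T : {set D}), {set D} * (D -> {set Y}).

Definition env_solver (X Y : finType) : Type :=
  forall (D : tsys X Y) (T : {set D}), {set D} * (D -> {set Y} -> {set X}).

Definition ag_solver_correct (X Y : finType) (solve : ag_solver X Y) : Prop :=
  forall (D : tsys X Y) (T : {set D}),
    (forall q, q \in (solve D T).1 <-> exists sag, wins_ag (safe T) q sag) /\
    (forall q, q \in (solve D T).1 ->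
       wins_ag (safe T) q (@strategy_of X Y (with_init q) (solve D T).2)).

Definition env_solver_correct (X Y : finType) (solve : env_solver X Y) : Prop :=
  forall (D : tsys X Y) (T : {set D}),
    (forall q, q \in (solve D T).1 <-> exists senv, wins_env (safe T) q senv) /\
    (forall q, q \in (solve D T).1 ->
       wins_env (safe T) q (@env_strategy_of X Y (with_init q) (solve D T).2)).

(* The sink is [None]. [insub q] is [Some] of [q] if [q \in S] and [None]
   otherwise, so the initial state is that of [D] whenever it belongs to [S]. *)
Definition restrict (X Y : finType) (D : tsys X Y) (S : {set D}) : tsys X Y :=
  @TSys X Y (option {q : D | q \in S}) (insub (init D))
    (fun q z => if q is Some q' then insub (delta (val q') z) else None).

Definition product (X Y : finType) (D1 D2 : tsys X Y) : tsys X Y :=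
  @TSys X Y (D1 * D2)%type (init D1, init D2)
    (fun q z => (delta q.1 z, delta q.2 z)).

(** Safety tasks under safety environment specifications *)

(* [(T1 x S2) U (Q1 x {sink})] *)
Definition goal_states (X Y : finType) (D1 D2 : tsys X Y) (T1 : {set D1})
    (S2 : {set D2}) : {set product D1 (restrict S2)} :=
  setX T1 [set Some q | q : {q : D2 | q \in S2}] :|: setX [set: D1] [set None].

(* [None] is the answer "Unrealisable". *)
Definition safety_synthesis (X Y : finType) (dfa_of : ltlf X Y -> dfa X Y)
    (solve_env : env_solver X Y) (solve_ag : ag_solver X Y)
    (phi1 phi2 : ltlf X Y) : option (ag_strategy X Y) :=
  let D1 := dfa_of phi1 in
  let D2 := dfa_of phi2 in
  let S2 := (solve_env D2 (convert_safe D2)).1 in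
  let D := product D1 (restrict S2) in
  let: (W, f) := solve_ag D (goal_states (convert_safe D1) S2) in
  if init D \in W then Some (strategy_of f) else None.

(** [play] is the unique trace following both strategies. *)

Lemma ag_part_join (X Y : finType) (y : {set Y}) (x : {set X}) :
  ag_part (join y x) = y.
Proof.
apply/setP=> p; rewrite !inE mem_imset; last by move=> ? ? [].
by rewrite orbC; case: imsetP => [[]|].
Qed.

Lemma env_part_join (X Y : finType) (y : {set Y}) (x : {set X}) :
  env_part (join y x) = x.
Proof.
apply/setP=> p; rewrite !inE [X in _ || X]mem_imset; last by move=> ? ? [].
by case: imsetP => [[]|].
Qed.

Lemma join_parts (X Y : finType) (z : letter X Y) :
  join (ag_part z) (env_part z) = z.
Proof.
apply/setP=> -[p|p]; rewrite !inE.
- rewrite [X in _ || X]mem_imset ?inE; last by move=> ? ? [].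
  by case: imsetP => [[]|].
- rewrite mem_imset ?inE; last by move=> ? ? [].
  by rewrite orbC; case: imsetP => [[]|].
Qed.

Lemma play_prefixE (X Y : finType) (sag : ag_strategy X Y)
    (senv : env_strategy X Y) n :
  play_prefix sag senv n = mkseq (play sag senv) n.
Proof.
have sz m : size (play_prefix sag senv m) = m.
  by elim: m => //= m IH; rewrite size_rcons IH.
elim: n => // n IH; rewrite mkseqS -IH /play /=.
by rewrite nth_rcons sz ltnn eqxx.
Qed.

Lemma playP (X Y : finType) (sag : ag_strategy X Y) (senv : env_strategy X Y)
    (tau : trace X Y) :
  follows_ag sag tau /\ follows_env senv tau <-> tau =1 play sag senv.
Proof.
have sz m : size (play_prefix sag senv m) = m.
  by rewrite play_prefixE size_mkseq.
have playE n : play sag senv n =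
    let y := sag (mkseq (fun j => env_part (play sag senv j)) n) in
    join y (senv (rcons (mkseq (fun j => ag_part (play sag senv j)) n) y)).
  rewrite {1}/play /= nth_rcons sz ltnn eqxx play_prefixE.
  by rewrite /mkseq -!map_comp.
have pag n : ag_part (play sag senv n) =
    sag (mkseq (fun j => env_part (play sag senv j)) n).
  by rewrite {1}playE ag_part_join.
split=> [[fa fe] n | E].
- elim/ltn_ind: n => n IH.
  have Eag : mkseq (fun j => ag_part (tau j)) n =
             mkseq (fun j => ag_part (play sag senv j)) n.
    by apply/eq_in_map => j; rewrite mem_iota => /andP[_ /IH ->].
  have Een : mkseq (fun j => env_part (tau j)) n =
             mkseq (fun j => env_part (play sag senv j)) n.
    by apply/eq_in_map => j; rewrite mem_iota => /andP[_ /IH ->].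
  by rewrite -[tau n]join_parts fe mkseqS fa Eag Een playE.
- split=> n; rewrite E.
  + by rewrite pag; congr sag; apply/eq_map => j; rewrite E.
  + rewrite {1}playE env_part_join -pag -mkseqS; congr senv.
    by apply/eq_map => j; rewrite E.
Qed.

(** The positional strategies play [f] along the run. *)

Lemma foldl_mkseqS (Q A : Type) (step : Q -> A -> Q) q (u : nat -> A) n :
  foldl step q (mkseq u n.+1) = step (foldl step q (mkseq u n)) (u n).
Proof. by rewrite mkseqS -cats1 foldl_cat. Qed.

Lemma strategy_ofP (X Y : finType) (D : tsys X Y) (f : D -> {set Y})
    (tau : trace X Y) :
  follows_ag (strategy_of f) tau <->
  forall n, ag_part (tau n) = f (run D tau n).
Proof.
pose st n := foldl (fun q x => delta q (join (f q) x)) (init D)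
  (mkseq (fun j => env_part (tau j)) n).
split=> H n.
- suff -> : run D tau n = st n by rewrite H.
  elim: n => // n IH.
  by rewrite /run /st !foldl_mkseqS -/(run D tau n) -/(st n) IH -{1}(join_parts (tau n)) H.
- rewrite H /strategy_of -/(st n); congr f.
  elim: n => // n IH.
  by rewrite /run /st !foldl_mkseqS -/(run D tau n) -/(st n) -IH -{1}(join_parts (tau n)) H.
Qed.

Lemma env_strategy_ofP (X Y : finType) (D : tsys X Y)
    (f : D -> {set Y} -> {set X}) (tau : trace X Y) :
  follows_env (env_strategy_of f) tau <->
  forall n, env_part (tau n) = f (run D tau n) (ag_part (tau n)).
Proof.
pose u j := ag_part (tau j).
pose st n := foldl (fun q y => delta q (join y (f q y))) (init D) (mkseq u n).
have E n : env_strategy_of f (mkseq u n.+1) = f (st n) (u n).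
  rewrite /env_strategy_of /st.
  case Eh: (mkseq u n.+1) => [|y h]; first by move: (size_mkseq u n.+1); rewrite Eh.
  by move: Eh; rewrite mkseqS lastI => /rcons_inj[-> ->].
split=> H n.
- suff -> : run D tau n = st n by rewrite H E.
  elim: n => // n IH.
  by rewrite /run /st !foldl_mkseqS -/(run D tau n) -/(st n) IH -{1}(join_parts (tau n)) H E.
- rewrite E H; congr (f _ _).
  elim: n => // n IH.
  by rewrite /run /st !foldl_mkseqS -/(run D tau n) -/(st n) -IH -{1}(join_parts (tau n)) H.
Qed.

(* Main.v *)
Require Import Defs.
From mathcomp Require Import all_boot.

Set Implicit Arguments.
Unset Strict Implicit.
Unset Printing Implicit Defensive.

(** Let [S2] be the set of states of the automaton of [phi2] from which the
    environment can stay safe. An environment strategy that enforces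
    [all_prefixes phi2] never leaves [S2], since after every history its
    residual strategy is still winning; hence against such a strategy the sink
    is never reached, and an agent strategy winning the product game enforces
    the task. Conversely, suppose that the agent strategy [sag] enforces the
    task, and let [tau] follow [sag] and stay in [S2] up to time [n]. Consider
    the environment strategy that copies the moves of [tau] as long as this
    keeps the run in [S2], and otherwise plays the positional winning function.
    It enforces [all_prefixes phi2], and its play against [sag] agrees with
    [tau] up to time [n]; so [tau] is safe for the task up to time [n], and
    [sag] wins the product game. *)

Definition splice (A : Type) (n : nat) (u v : nat -> A) : nat -> A :=
  fun i => if i < n then u i else v (i - n).

Lemma mkseq_splice (A B : Type) (g : A -> B) n m (u v : nat -> A) :
  mkseq (fun i => g (splice n u v i)) (n + m) =
  mkseq (fun i => g (u i)) n ++ mkseq (fun i => g (v i)) m.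
Proof.
rewrite /mkseq iotaD map_cat; congr (_ ++ _).
  by apply/eq_in_map => i; rewrite mem_iota /splice => /andP[_ ->].
have -> : iota (0 + n) m = map (addn n) (iota 0 m) by rewrite -iotaDl addn0.
rewrite -map_comp; apply/eq_map => i /=.
by rewrite /splice ltnNge leq_addr /= addKn.
Qed.

Section Runs.

Variables (X Y : finType).
Implicit Types (D : tsys X Y) (tau : trace X Y).

Lemma run0 D tau : run D tau 0 = init D.
Proof. by []. Qed.

Lemma runS D tau n : run D tau n.+1 = delta (run D tau n) (tau n).
Proof. exact: foldl_mkseqS. Qed.

Lemma eq_run D tau tau' n :
  mkseq tau n = mkseq tau' n -> run D tau n = run D tau' n.
Proof. by rewrite /run => ->. Qed.

Lemma run_splice D tau tau' n m :
  run D (splice n tau tau') (n + m) = run (with_init (run D tau n)) tau' m.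
Proof. by rewrite /run (mkseq_splice id) foldl_cat. Qed.

Lemma run_product D1 D2 tau n :
  run (product D1 D2) tau n = (run D1 tau n, run D2 tau n).
Proof. by elim: n => // n IH; rewrite !runS IH. Qed.

(** The sink is absorbing, so every state before time [n] has to be tested; [insub] tests the state
    at time [n] itself. *)
Lemma run_restrict D (S : {set D}) tau n :
  run (restrict S) tau n =
  if all (fun k => run D tau k \in S) (iota 0 n) then insub (run D tau n)
  else None.
Proof.
elim: n => // n IH; rewrite runS IH -addn1 iotaD all_cat /= andbT add0n addn1.
case: all => //=; case: insubP => [u Pu Eu|/negbTE ->] //=.
by rewrite Pu Eu -runS.
Qed.

Lemma in_goal_states D1 D2 (T1 : {set D1}) (S2 : {set D2}) q1 q2 :
  ((q1, q2) \in goal_states T1 S2) = (q2 == None) || (q1 \in T1).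
Proof.
rewrite !inE /= orbC; case: q2 => [u|] //.
by rewrite imset_f ?andbT.
Qed.

(** The initial state counts as safe only for time 0, where no letter has been read. It never
    recurs, so at later times safety means acceptance of the prefix. *)
Lemma all_prefixes_safe (M : dfa X Y) phi tau :
  recognizes M phi -> init_not_reentered M ->
  all_prefixes phi tau <-> safe (convert_safe M) (run M tau).
Proof.
move=> recM initM; split=> H [|n].
- by move=> *; rewrite run0 !inE eqxx orbT.
- rewrite !inE; apply/orP; left; apply/recM; split; last exact: H.
  by rewrite mkseqS; case: mkseq.
- by [].
- have nz : mkseq tau n.+1 <> [::] by rewrite mkseqS; case: mkseq.
  move=> _; have := H n.+1; rewrite !inE => /orP[/recM[]//|/eqP E].
  by case: (initM _ nz).
Qed.

Lemma eq_all_prefixes (phi : ltlf X Y) tau tau' :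
  tau =1 tau' -> all_prefixes phi tau -> all_prefixes phi tau'.
Proof. by move=> E H n n0; rewrite -(eq_mkseq E); apply: H. Qed.

Lemma env_enforces_follows (senv : env_strategy X Y) phi tau :
  env_enforces senv (all_prefixes phi) -> follows_env senv tau ->
  all_prefixes phi tau.
Proof.
(* This agent replays its moves in [tau] whatever the environment does, so its play against [senv]
   is [tau]. *)
move=> H F; pose sag : ag_strategy X Y := fun h => ag_part (tau (size h)).
apply: eq_all_prefixes (H sag) => n; apply/esym.
by apply: (playP sag senv tau).1; split=> // i; rewrite /sag size_mkseq.
Qed.

(** The trace [tau'] follows the residual of [senv] after the first [n] agent moves of [tau]. *)
Lemma follows_env_splice (senv : env_strategy X Y) tau tau' n :
  follows_env senv tau ->
  follows_env
    (fun h => senv (mkseq (fun i => ag_part (tau i)) n ++ h)) tau' ->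
  follows_env senv (splice n tau tau').
Proof.
move=> F F' i; case: (ltnP i n) => [lt_in|le_ni].
- rewrite {1}/splice lt_in F; congr senv; apply/eq_in_map => j.
  rewrite mem_iota add0n => /andP[_ lt_ji].
  by rewrite /splice (leq_trans lt_ji lt_in).
- by rewrite -(subnKC le_ni) -addnS mkseq_splice /splice ltnNge leq_addr /= addKn.
Qed.

End Runs.

Section HistoryStrategy.

Variables (X Y : finType) (g : seq (letter X Y) -> {set Y} -> {set X}).

(** An environment strategy sees only agent moves. Its own past moves are determined by them, so the
    full history can be rebuilt and passed to [g]. *)
Definition response (ys : seq {set Y}) : seq (letter X Y) :=
  foldl (fun w y => rcons w (join y (g w y))) [::] ys.

Definition history_strategy : env_strategy X Y :=
  fun ys => if ys is y :: ys' then g (response (belast y ys')) (last y ys')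
            else set0.

Lemma history_strategy_follows (tau : trace X Y) :
  follows_env history_strategy tau ->
  forall n, env_part (tau n) = g (mkseq tau n) (ag_part (tau n)).
Proof.
pose u j := ag_part (tau j).
have E n : history_strategy (mkseq u n.+1) = g (response (mkseq u n)) (u n).
  rewrite /history_strategy; case Eh: (mkseq u n.+1) => [|y h].
    by move: (size_mkseq u n.+1); rewrite Eh.
  by move: Eh; rewrite mkseqS lastI => /rcons_inj[-> ->].
move=> F n; suff Er : response (mkseq u n) = mkseq tau n.
  by rewrite F -/u E Er.
elim: n => // n IH.
rewrite /response foldl_mkseqS -/(response _) IH mkseqS.
by rewrite -[in RHS](join_parts (tau n)) F -/u E IH.
Qed.

End HistoryStrategy.

Section SafetyGame.

Variables (X Y : finType) (solve_env : env_solver X Y).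
Hypothesis Henv : env_solver_correct solve_env.
Variables (D : tsys X Y) (T : {set D}).

Let S := (solve_env T).1.
Let f := (solve_env T).2.

Lemma env_region_safe q : q \in S -> q \in T.
Proof.
(* Winning constrains only traces that follow the strategy, so one such trace is produced, with an
   arbitrary agent, and read at time 0. *)
move=> /(Henv T).2 W; pose tau0 : trace X Y :=
  play (fun=> set0) (@env_strategy_of X Y (with_init q) f).
have [_ F] := (playP (fun=> set0) _ tau0).2 (fun=> erefl).
exact: W F 0.
Qed.

(** As the strategy is positional, putting this letter before a trace that follows [f] from the
    successor gives one that follows [f] from [q], where [f] wins. *)
Lemma env_region_step q y : q \in S -> delta q (join y (f q y)) \in S.
Proof.
move=> qS; set q' := delta _ _; apply/(Henv T).1.
exists (@env_strategy_of X Y (with_init q') f) => tau F m.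
pose sigma := splice 1 (fun=> join y (f q y)) tau.
have Erun k : run (with_init q) sigma k.+1 = run (with_init q') tau k.
  by rewrite -[k.+1]add1n run_splice.
suff /((Henv T).2 q qS)/(_ m.+1) : follows_env
    (@env_strategy_of X Y (with_init q) f) sigma by rewrite Erun.
apply/env_strategy_ofP => -[|k].
  by rewrite run0 /sigma /splice /= env_part_join ag_part_join.
by rewrite Erun /sigma /splice /= subSS subn0; apply: (env_strategy_ofP _ _).1.
Qed.

Lemma env_enforcing_run_in_region (senv : env_strategy X Y) tau n :
  (forall sigma, follows_env senv sigma -> safe T (run D sigma)) ->
  follows_env senv tau -> run D tau n \in S.
Proof.
move=> safeT F; apply/(Henv T).1.
exists (fun h => senv (mkseq (fun i => ag_part (tau i)) n ++ h)) => tau' F' m.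
by rewrite -run_splice; apply: safeT; apply: follows_env_splice F F'.
Qed.

(** The test is made afresh at each move, even after a deviation from [tau]; this makes membership
    in [S] a one-step invariant. *)
Definition imitate (tau : trace X Y) : env_strategy X Y :=
  history_strategy (fun w y =>
    let q := foldl (@delta X Y D) (init D) w in
    let x := env_part (tau (size w)) in
    if delta q (join y x) \in S then x else f q y).

Lemma imitate_move tau sigma n : follows_env (imitate tau) sigma ->
  env_part (sigma n) =
  let q := run D sigma n in
  let x := env_part (tau n) in
  let y := ag_part (sigma n) in
  if delta q (join y x) \in S then x else f q y.
Proof. by move=> /history_strategy_follows ->; rewrite size_mkseq. Qed.

Lemma imitate_safe tau sigma : init D \in S ->
  follows_env (imitate tau) sigma -> safe T (run D sigma).
Proof.
move=> initS F n; apply: env_region_safe; elim: n => // n IH.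
rewrite runS -(join_parts (sigma n)) (imitate_move _ F) /=.
by case: ifP => // _; apply: env_region_step.
Qed.

(** Equal histories give equal agent moves, and the environment then copies [tau] because the next
    state of [tau] is in [S]; hence the bound [k <= n]. *)
Lemma imitate_agrees (sag : ag_strategy X Y) tau n : follows_ag sag tau ->
  (forall k, k <= n -> run D tau k \in S) ->
  mkseq (play sag (imitate tau)) n = mkseq tau n.
Proof.
set sigma := play _ _ => Ftau.
have [Fag Fenv] := (playP sag (imitate tau) sigma).2 (fun=> erefl).
elim: n => // n IH inS.
have {}IH : mkseq sigma n = mkseq tau n.
  by apply: IH => k /leqW; apply: inS.
have Eag : ag_part (sigma n) = ag_part (tau n).
  have mapE rho : mkseq (fun j => env_part (rho j)) n =
    map (@env_part X Y) (mkseq rho n) by rewrite /mkseq -map_comp.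
  by rewrite Fag Ftau !mapE IH.
rewrite !mkseqS IH -[sigma n]join_parts (imitate_move _ Fenv) /= Eag.
by rewrite (eq_run D IH) join_parts -runS inS // join_parts.
Qed.

End SafetyGame.

Lemma finite_state_strategy_of (X Y : finType) (D : tsys X Y)
    (f : D -> {set Y}) : finite_state (strategy_of f).
Proof. by exists D, (init D), (fun q x => delta q (join (f q) x)), f. Qed.

Theorem theorem7 (X Y : finType)
  (dfa_of : ltlf X Y -> dfa X Y)
  (solve_env : env_solver X Y) (solve_ag : ag_solver X Y)
  (Hdfa : dfa_construction dfa_of)
  (Henv : env_solver_correct solve_env)
  (Hag : ag_solver_correct solve_ag)
  (phi1 phi2 : ltlf X Y)
  (Hcons : consistent (all_prefixes phi2)) :
  match safety_synthesis dfa_of solve_env solve_ag phi1 phi2 with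
  | None =>
      ~ exists sag : ag_strategy X Y,
          enforces_under sag (all_prefixes phi1) (all_prefixes phi2)
  | Some sag =>
      finite_state sag /\
      enforces_under sag (all_prefixes phi1) (all_prefixes phi2)
  end.
Proof.
rewrite /safety_synthesis.
set D1 := dfa_of phi1; set D2 := dfa_of phi2; set T2 := convert_safe D2.
set S2 := (solve_env _ _).1; set T := goal_states _ _.
have spec1 tau := all_prefixes_safe tau (Hdfa phi1).1 (Hdfa phi1).2.
have spec2 tau := all_prefixes_safe tau (Hdfa phi2).1 (Hdfa phi2).2.
have stay senv tau n : env_enforces senv (all_prefixes phi2) ->
    follows_env senv tau -> run D2 tau n \in S2.
  move=> E; apply: (env_enforcing_run_in_region Henv) => sigma F.
  exact/spec2/(env_enforces_follows E F).
have [Wreg Wstrat] := Hag _ T.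
case EW: (solve_ag _ _) => [W f] in Wreg Wstrat *; rewrite /= in Wreg Wstrat.
case: ifP => [initW|/negP initW].
- split=> [|senv E]; first exact: finite_state_strategy_of.
  set tau := play _ _.
  have [Fag Fenv] := (playP (strategy_of f) senv tau).2 (fun=> erefl).
  apply/spec1 => n; have := Wstrat _ initW tau Fag n.
  rewrite -[run _ tau n]/(run (product D1 (restrict S2)) tau n).
  rewrite run_product in_goal_states run_restrict.
  have -> : all (fun k => run D2 tau k \in S2) (iota 0 n).
    by apply/allP => k _; apply: stay Fenv.
  by rewrite insubT //; apply: stay Fenv.
- case=> sag Esag; apply: initW; apply/Wreg; exists sag => tau Fag n.
  rewrite -[run _ tau n]/(run (product D1 (restrict S2)) tau n).
  rewrite run_product in_goal_states run_restrict.
  (* If [tau] has left [S2] by time [n], the product is in the sink, which is a goal state. *)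
  case: allP => //= inS; case: insubP => //= u inSn _.
  have {inSn}inS k : k <= n -> run D2 tau k \in S2.
    rewrite leq_eqVlt => /predU1P[-> //|lt_kn].
    by apply: inS; rewrite mem_iota.
  have initS : init D2 \in S2 by rewrite -(run0 D2 tau); apply: inS.
  have Eimit : env_enforces (imitate solve_env T2 tau) (all_prefixes phi2).
    move=> sag'; apply/spec2; apply: (imitate_safe Henv initS).
    exact: ((playP sag' _ _).2 (fun=> erefl)).2.
  rewrite -(eq_run D1 (imitate_agrees Fag inS)).
  exact: (spec1 _).1 (Esag _ Eimit) n.
Qed.
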